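(* There is a polynomial-time algorithm for the SBFE problem for monotone $k$-DNF formulas that, given a monotone $k$-DNF formula $f$ on variables $x_1,\ldots,x_n$, a probability vector $p$ and a cost vector $c$, computes a testing strategy whose expected cost (with respect to $D_p$) is at most $\frac{4}{\rho^k}\, E[CERT(f,x)]$, where $\rho = \min_i \min\{p_i, 1-p_i\}$.
   Context: SBFE problem: given a formula for $f(x_1,\ldots,x_n)$, probabilities $p=(p_1,\ldots,p_n)$ with $0<p_i<1$ and costs $c=(c_1,\ldots,c_n)$ with $c_i\ge 0$, an unknown $x\in\{0,1\}^n$ is drawn from the product distribution $D_p$ ($\Pr[x_i=1]=p_i$ independently); the value of $x_i$ is learned only by testing it at cost $c_i$; tests are performed sequentially and adaptively until $f(x)$ is determined, and the goal is to minimize expected total cost. Running time of the algorithm means the worst-case time to choose the next test or output the value. A monotone $k$-DNF is a disjunction of terms, each a conjunction of at most $k$ unnegated variables. A partial assignment $b\in\{0,1,*\}^n$ is a 0-certificate (1-certificate) of $f$ if $f(a)=0$ ($f(a)=1$) for all $a$ agreeing with $b$ on its non-$*$ positions; its cost is $\sum_{j: b_j\neq *} c_j$; $x$ contains $b$ if $x_i=b_i$ for all $b_i\ne *$. $CERT(f,x)$ is the minimum cost of a certificate (0- or 1-) of $f$ contained in $x$, and $E[CERT(f,x)]$ is its expectation for $x \sim D_p$ (the expected certificate cost). *)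

(* Defs.v *)
From Corelib Require Import BinNums.
From mathcomp Require Import all_boot all_order all_algebra.

Set Implicit Arguments.
Unset Strict Implicit.
Unset Printing Implicit Defensive.

Import Order.TTheory GRing.Theory Num.Theory.

(* Model of computation: N. D. Jones's WHILE language over binary trees
   (Computability and Complexity from a Programming Perspective, MIT Press
   1997), every operation having unit cost.  Its polynomial-time computable
   problems are those of Turing machines: a store is a shared graph of cells,
   to which each step adds at most a constant number of cells. *)

Inductive tree := Leaf | Node of tree & tree.

Fixpoint tree_size (u : tree) : nat :=
  if u is Node u1 u2 then (tree_size u1 + tree_size u2).+1 else 1.

Inductive expr :=
  | EVar of nat
  | ELeaf
  | ENode of expr & expr
  | EHd of expr
  | ETl of expr.

Inductive cmd :=
  | Assign of nat & expr
  | Seq of cmd & cmd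
  | If of expr & cmd & cmd
  | While of expr & cmd.

Definition store := nat -> tree.

Definition update (s : store) (x : nat) (u : tree) : store :=
  fun y => if y == x then u else s y.

Definition hd (u : tree) : tree := if u is Node u1 _ then u1 else Leaf.
Definition tl (u : tree) : tree := if u is Node _ u2 then u2 else Leaf.
Definition truthy (u : tree) : bool := if u is Node _ _ then true else false.

Fixpoint eval (s : store) (e : expr) : tree :=
  match e with
  | EVar x => s x
  | ELeaf => Leaf
  | ENode e1 e2 => Node (eval s e1) (eval s e2)
  | EHd e1 => hd (eval s e1)
  | ETl e1 => tl (eval s e1)
  end.

Fixpoint expr_time (e : expr) : nat :=
  match e with
  | EVar _ | ELeaf => 1
  | ENode e1 e2 => (expr_time e1 + expr_time e2).+1
  | EHd e1 | ETl e1 => (expr_time e1).+1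
  end.

(* [exec c s t s']: started in store [s], command [c] halts in store [s']
   after [t] time units. *)
Inductive exec : cmd -> store -> nat -> store -> Prop :=
  | exec_assign x e s :
      exec (Assign x e) s (expr_time e).+1 (update s x (eval s e))
  | exec_seq c1 c2 s1 t1 s2 t2 s3 :
      exec c1 s1 t1 s2 -> exec c2 s2 t2 s3 ->
      exec (Seq c1 c2) s1 (t1 + t2).+1 s3
  | exec_if e c1 c2 s t s' :
      exec (if truthy (eval s e) then c1 else c2) s t s' ->
      exec (If e c1 c2) s (expr_time e + t).+1 s'
  | exec_while_end e c s :
      ~~ truthy (eval s e) -> exec (While e c) s (expr_time e).+1 s
  | exec_while_loop e c s1 t1 s2 t2 s3 :
      truthy (eval s1 e) -> exec c s1 t1 s2 -> exec (While e c) s2 t2 s3 ->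
      exec (While e c) s1 (expr_time e + t1 + t2).+1 s3.

(* Variable 0 holds the input at the start and the output at the end; all
   other variables start out as [Leaf]. *)
Definition runs_within (A : cmd) (input output : tree) (T : nat) : Prop :=
  exists t s, [/\ exec A (update (fun=> Leaf) 0 input) t s,
                  s 0 = output & t <= T].

Fixpoint pos_bits (m : positive) : seq bool :=
  match m with
  | xH => [:: true]
  | xO m' => false :: pos_bits m'
  | xI m' => true :: pos_bits m'
  end.

Definition nat_bits (m : nat) : seq bool :=
  if bin_of_nat m is Npos m' then pos_bits m' else [::].

Definition enc_seq (T : Type) (enc : T -> tree) (s : seq T) : tree :=
  foldr (fun a u => Node (enc a) u) Leaf s.

Definition enc_bool (v : bool) : tree := if v then Node Leaf Leaf else Leaf.

Definition enc_nat (m : nat) : tree := enc_seq enc_bool (nat_bits m).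

(* Numerator and denominator in lowest terms, both in binary.  There is no
   sign, since only nonnegative rationals are ever encoded. *)
Definition enc_rat (r : rat) : tree :=
  Node (enc_nat `|numq r|) (enc_nat `|denq r|).

(* Variable indices are in unary; as an instance lists the n probabilities and
   costs anyway, this affects its size only polynomially. *)
Definition enc_var (n : nat) (i : 'I_n) : tree := iter i (Node Leaf) Leaf.

Definition point (n : nat) := {ffun 'I_n -> bool}.

(* [None] plays the role of *. *)
Definition passign (n : nat) := {ffun 'I_n -> option bool}.

(* A monotone DNF formula is the list of its terms, and a term is the list of
   its variables. *)
Definition dnf (n : nat) := seq (seq 'I_n).

Definition dnf_eval (n : nat) (f : dnf n) (x : point n) : bool :=
  has (fun term : seq 'I_n => all x term) f.

Definition is_kdnf (n k : nat) (f : dnf n) : bool :=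
  all (fun term : seq 'I_n => size term <= k) f.

Definition contains (n : nat) (x : point n) (b : passign n) : bool :=
  [forall i, (b i == None) || (b i == Some (x i))].

Definition is_vcert (n : nat) (f : dnf n) (v : bool) (b : passign n) : bool :=
  [forall a : point n, contains a b ==> (dnf_eval f a == v)].

Definition is_cert (n : nat) (f : dnf n) (b : passign n) : bool :=
  is_vcert f false b || is_vcert f true b.

Definition unknown (n : nat) : passign n := [ffun=> None].

Definition learn (n : nat) (b : passign n) (i : 'I_n) (v : bool) : passign n :=
  [ffun j => if j == i then Some v else b j].

(* [Test i S0 S1] tests x_i and goes on with [S0] if x_i = 0, with [S1] if
   x_i = 1. *)
Inductive strategy (n : nat) :=
  | Output of bool
  | Test of 'I_n & strategy n & strategy n.

(* No variable is tested twice, and testing goes on exactly until the value of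
   f is determined by the results known so far (the partial assignment [b]). *)
Fixpoint evaluates (n : nat) (f : dnf n) (b : passign n) (S : strategy n) :
    Prop :=
  match S with
  | Output v => is_vcert f v b
  | Test i S0 S1 =>
      [/\ b i = None, ~~ is_cert f b,
          evaluates f (learn b i false) S0 & evaluates f (learn b i true) S1]
  end.

Local Open Scope ring_scope.

Fixpoint strategy_cost (n : nat) (c : 'I_n -> rat) (S : strategy n)
    (x : point n) : rat :=
  match S with
  | Output _ => 0
  | Test i S0 S1 => c i + strategy_cost c (if x i then S1 else S0) x
  end.

Definition expectation (n : nat) (p : 'I_n -> rat) (g : point n -> rat) : rat :=
  \sum_(x : point n) (\prod_(i < n) (if x i then p i else 1 - p i)) * g x.

Definition passign_cost (n : nat) (c : 'I_n -> rat) (b : passign n) : rat :=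
  \sum_(j < n | b j != None) c j.

(* The default value of the minimum is the cost of x itself, viewed as a
   certificate in which every position is specified. *)
Definition CERT (n : nat) (f : dnf n) (c : 'I_n -> rat) (x : point n) : rat :=
  \big[Num.min / \sum_(j < n) c j]_(b : passign n | is_cert f b && contains x b)
    passign_cost c b.

(* The default value 1 exceeds every p_i, so it matters only when n = 0. *)
Definition rho (n : nat) (p : 'I_n -> rat) : rat :=
  \big[Num.min / 1]_(i < n) Num.min (p i) (1 - p i).

Definition enc_instance (n : nat) (f : dnf n) (p c : 'I_n -> rat) : tree :=
  Node (enc_seq (enc_seq (@enc_var n)) f)
       (Node (enc_seq enc_rat [seq p i | i <- enum 'I_n])
             (enc_seq enc_rat [seq c i | i <- enum 'I_n])).

(* The tests made so far and their results, in chronological order. *)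
Definition enc_history (n : nat) (h : seq ('I_n * bool)) : tree :=
  enc_seq (fun iv => Node (enc_var iv.1) (enc_bool iv.2)) h.

Definition enc_next (n : nat) (S : strategy n) : tree :=
  match S with
  | Output v => Node (enc_bool false) (enc_bool v)
  | Test i _ _ => Node (enc_bool true) (enc_var i)
  end.

(* After each history that extends [h] along a path of [S], the program [A],
   given the instance and that history, returns the corresponding test or
   output of [S] within time [T]. *)
Fixpoint computes (n : nat) (A : cmd) (f : dnf n) (p c : 'I_n -> rat) (T : nat)
    (h : seq ('I_n * bool)) (S : strategy n) : Prop :=
  runs_within A (Node (enc_instance f p c) (enc_history h)) (enc_next S) T /\
  match S with
  | Output _ => True
  | Test i S0 S1 =>
      computes A f p c T (rcons h (i, false)) S0 /\
      computes A f p c T (rcons h (i, true)) S1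
  end.

(* Main.v *)
(* Process the terms in a fixed order of increasing maximal cost, always testing
   the first untested variable of the first term that is not yet falsified.  Let
   M be the maximal cost in the current term.  A term satisfied by x is never
   falsified, so if f(x) = 1 then every certificate of x costs at least M.  The
   variables of the current term are tested until one of them is 0, and the
   expected cost of this, relative to the probability that the term turns out to
   be satisfied, is at most M (1/rho + ... + 1/rho^k) <= 2 M / rho^k, because
   rho <= 1/2.  Hence the total expected cost is at most (2/rho^k) E[CERT].
   Another factor 2 is lost by ordering the terms only approximately: two costs
   are told apart by a power of 2 lying between them, which takes no arithmetic
   beyond comparing binary numbers and dropping low-order bits.

   The algorithm is written in a small functional language whose only loops are
   folds over lists.  As long as those lists are subtrees of the input, the
   running time of the compiled program is polynomial whatever the program. *)

Require Import Defs.
From mathcomp Require Import all_boot all_order all_algebra.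
From mathcomp Require Import zify ring lra.

Set Implicit Arguments.
Unset Strict Implicit.
Unset Printing Implicit Defensive.

Import Order.TTheory GRing.Theory Num.Theory.

(** * A language of bounded folds and its compiler *)

(* Variables are de Bruijn indices. *)
Inductive pexp :=
  | PVar of nat
  | PLeaf
  | PNode of pexp & pexp
  | PHd of pexp
  | PTl of pexp
  | PIf of pexp & pexp & pexp
  | PLet of pexp & pexp
  | PFold of pexp & pexp & pexp.

(* The step function sees the current suffix of the list, not only its head. *)
Fixpoint tfold (g : tree -> tree -> tree) (l a : tree) : tree :=
  if l is Node _ l' then tfold g l' (g l a) else a.

Fixpoint den (env : seq tree) (e : pexp) : tree :=
  match e with
  | PVar i => nth Leaf env i
  | PLeaf => Leaf
  | PNode e1 e2 => Node (den env e1) (den env e2)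
  | PHd e1 => hd (den env e1)
  | PTl e1 => tl (den env e1)
  | PIf e1 e2 e3 => if truthy (den env e1) then den env e2 else den env e3
  | PLet e1 e2 => den (den env e1 :: env) e2
  | PFold l i b =>
      tfold (fun u a => den [:: u, a & env] b) (den env l) (den env i)
  end.

(* Variable [j] of the expression lives in register [nth 0 m j]; the result is
   left in register [r], and no register below [r] is modified. *)
Fixpoint comp (m : seq nat) (r : nat) (e : pexp) : cmd :=
  match e with
  | PVar i => Assign r (if i < size m then EVar (nth 0 m i) else ELeaf)
  | PLeaf => Assign r ELeaf
  | PNode e1 e2 =>
      Seq (comp m r e1)
          (Seq (comp m r.+1 e2) (Assign r (ENode (EVar r) (EVar r.+1))))
  | PHd e1 => Seq (comp m r e1) (Assign r (EHd (EVar r)))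
  | PTl e1 => Seq (comp m r e1) (Assign r (ETl (EVar r)))
  | PIf e1 e2 e3 => Seq (comp m r e1) (If (EVar r) (comp m r e2) (comp m r e3))
  | PLet e1 e2 =>
      Seq (comp m r e1) (Seq (comp (r :: m) r.+1 e2) (Assign r (EVar r.+1)))
  | PFold l i b =>
      Seq (comp m r i)
          (Seq (comp m r.+1 l)
               (While (EVar r.+1)
                      (Seq (comp [:: r.+1, r & m] r.+2 b)
                           (Seq (Assign r (EVar r.+2))
                                (Assign r.+1 (ETl (EVar r.+1)))))))
  end.

(* A sufficient condition for the value of [e] to be no larger than the largest
   value of a variable flagged in [G]. *)
Fixpoint small (G : seq bool) (e : pexp) : bool :=
  match e with
  | PVar i => nth false G i
  | PLeaf => true
  | PNode _ _ => false
  | PHd e1 | PTl e1 => small G e1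
  | PIf _ e2 e3 => small G e2 && small G e3
  | PLet e1 e2 => small (small G e1 :: G) e2
  | PFold l i b => [&& small G l, small G i & small [:: true, true & G] b]
  end.

(** An accumulator that may grow is allowed, but its flag in the body is then off, so no inner fold
    can take its list from it. *)
Fixpoint folds_small (G : seq bool) (e : pexp) : bool :=
  match e with
  | PVar _ | PLeaf => true
  | PNode e1 e2 => folds_small G e1 && folds_small G e2
  | PHd e1 | PTl e1 => folds_small G e1
  | PIf e1 e2 e3 => [&& folds_small G e1, folds_small G e2 & folds_small G e3]
  | PLet e1 e2 => folds_small G e1 && folds_small (small G e1 :: G) e2
  | PFold l i b =>
      [&& folds_small G l, folds_small G i, small G l
        & folds_small [:: true,
                          small G i && small [:: true, true & G] b & G] b]
  end.

(** An upper bound: both branches of a conditional are charged, and a fold is charged N iterations,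
    each with 9 units for the loop test, the two assignments and the sequencing. *)
Fixpoint pexp_time (N : nat) (e : pexp) : nat :=
  match e with
  | PVar _ | PLeaf => 2
  | PNode e1 e2 => pexp_time N e1 + pexp_time N e2 + 6
  | PHd e1 | PTl e1 => pexp_time N e1 + 4
  | PIf e1 e2 e3 => pexp_time N e1 + pexp_time N e2 + pexp_time N e3 + 3
  | PLet e1 e2 => pexp_time N e1 + pexp_time N e2 + 4
  | PFold l i b =>
      pexp_time N i + pexp_time N l + N * (pexp_time N b + 9) + 4
  end.

Definition flagged_le (N : nat) (G : seq bool) (env : seq tree) : Prop :=
  forall i, nth false G i -> tree_size (nth Leaf env i) <= N.

(** Keeping the environment registers below [r] protects them from compiled code, which writes only
    from [r] upwards. *)
Definition store_agrees (m : seq nat) (r : nat) (s : store) (env : seq tree) :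
    Prop :=
  size m = size env /\
  forall i, i < size m -> nth 0 m i < r /\ s (nth 0 m i) = nth Leaf env i.

Lemma tree_size_gt0 u : 0 < tree_size u.
Proof. by case: u. Qed.

Lemma tree_size_hd u : tree_size (hd u) <= tree_size u.
Proof. by case: u => //= u1 u2; rewrite ltnW // ltnS leq_addr. Qed.

Lemma tree_size_tl u : tree_size (tl u) <= tree_size u.
Proof. by case: u => //= u1 u2; rewrite ltnW // ltnS leq_addl. Qed.

Lemma flagged_le_cons N (b : bool) G u env :
  (b -> tree_size u <= N) -> flagged_le N G env ->
  flagged_le N (b :: G) (u :: env).
Proof. by move=> hu hG [|i]; [exact: hu | exact: hG]. Qed.

Lemma tfold_inv (P : tree -> Prop) N g l a :
  tree_size l <= N ->
  (forall u a', tree_size u <= N -> P a' -> P (g u a')) ->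
  P a -> P (tfold g l a).
Proof.
move=> hl hg; elim: l hl a => [|u1 _ u2 IH] //= hl a Pa.
by apply: IH; [lia | exact: hg].
Qed.

(** Without [PNode] in value position, values can only be selected from flagged ones, never built.
    For a fold, the bound on the accumulator is an invariant. *)
Lemma small_den N e : 0 < N ->
  forall G env, flagged_le N G env -> small G e -> tree_size (den env e) <= N.
Proof.
move=> N0; elim: e => [i||e1 _ e2 _|e1 IH|e1 IH|e1 _ e2 IH2 e3 IH3
    |e1 IH1 e2 IH2|l IHl i IHi b IHb] G env hG //=.
- exact: hG.
- by move=> /(IH _ _ hG); apply: leq_trans; exact: tree_size_hd.
- by move=> /(IH _ _ hG); apply: leq_trans; exact: tree_size_tl.
- by case/andP=> /(IH2 _ _ hG) h2 /(IH3 _ _ hG) h3; case: ifP.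
- by apply: IH2; apply: flagged_le_cons => //; exact: IH1.
- case/and3P=> /(IHl _ _ hG) hl /(IHi _ _ hG) hi hb.
  apply: (@tfold_inv (fun a => tree_size a <= N) N) => // u a hu ha.
  by apply: IHb hb; do 2!apply: flagged_le_cons => //.
Qed.

Lemma update_same s x u : update s x u x = u.
Proof. by rewrite /update eqxx. Qed.

Lemma update_lt s x u y : y < x -> update s x u y = s y.
Proof. by rewrite /update; case: eqP => // ->; rewrite ltnn. Qed.

Lemma store_agrees_le m r r' s s' env : r <= r' ->
  (forall x, x < r -> s' x = s x) ->
  store_agrees m r s env -> store_agrees m r' s' env.
Proof.
move=> le_r hs [hm hi]; split=> // i /hi[lt_i <-].
by rewrite hs // (leq_trans lt_i).
Qed.

Lemma store_agrees_cons m r s env :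
  store_agrees m r s env -> store_agrees (r :: m) r.+1 s (s r :: env).
Proof.
case=> hm hi; split=> [|[|i]] //=; first by rewrite hm.
by rewrite ltnS => /hi[lt_i ->]; split=> //; exact: ltnW.
Qed.

Lemma comp_exec N e : 0 < N -> forall m r s G env,
  store_agrees m r s env -> flagged_le N G env -> folds_small G e ->
  exists t s', [/\ exec (comp m r e) s t s', s' r = den env e,
                   forall x, x < r -> s' x = s x & t <= pexp_time N e].
Proof.
move=> N0; elim: e => [i||e1 IH1 e2 IH2|e1 IH1|e1 IH1|e1 IH1 e2 IH2 e3 IH3
    |e1 IH1 e2 IH2|l IHl i IHi b IHb] m r s G env ag hG /=.
- move=> _; do 2!eexists; split; first exact: exec_assign.
  + rewrite update_same; case: ag => hm hi; case: ifP => lt_i /=.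
      by case: (hi i lt_i).
    by rewrite nth_default // -hm leqNgt lt_i.
  + by move=> x lt_x; rewrite update_lt.
  + by case: ifP.
- move=> _; do 2!eexists; split; first exact: exec_assign.
  + exact: update_same.
  + by move=> x lt_x; rewrite update_lt.
  + by [].
- case/andP=> w1 w2.
  have [t1 [s1 [ex1 v1 k1 le1]]] := IH1 _ _ _ _ _ ag hG w1.
  have ag1 : store_agrees m r.+1 s1 env by apply: store_agrees_le ag.
  have [t2 [s2 [ex2 v2 k2 le2]]] := IH2 _ _ _ _ _ ag1 hG w2.
  do 2!eexists; split.
  + by apply: exec_seq ex1 _; apply: exec_seq ex2 _; exact: exec_assign.
  + by rewrite update_same /= v2 k2 // v1.
  + by move=> x lt_x; rewrite update_lt // k2 ?k1 // ltnW.
  + rewrite /=; lia.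
- move=> w1; have [t1 [s1 [ex1 v1 k1 le1]]] := IH1 _ _ _ _ _ ag hG w1.
  do 2!eexists; split; first by apply: exec_seq ex1 _; exact: exec_assign.
  + by rewrite update_same /= v1.
  + by move=> x lt_x; rewrite update_lt // k1.
  + rewrite /=; lia.
- move=> w1; have [t1 [s1 [ex1 v1 k1 le1]]] := IH1 _ _ _ _ _ ag hG w1.
  do 2!eexists; split; first by apply: exec_seq ex1 _; exact: exec_assign.
  + by rewrite update_same /= v1.
  + by move=> x lt_x; rewrite update_lt // k1.
  + rewrite /=; lia.
- case/and3P=> w1 w2 w3.
  have [t1 [s1 [ex1 v1 k1 le1]]] := IH1 _ _ _ _ _ ag hG w1.
  have ag1 : store_agrees m r s1 env by apply: store_agrees_le ag.
  have [t2 [s2 [ex2 v2 k2 le2]]] := IH2 _ _ _ _ _ ag1 hG w2.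
  have [t3 [s3 [ex3 v3 k3 le3]]] := IH3 _ _ _ _ _ ag1 hG w3.
  case: (boolP (truthy (den env e1))) => h1.
  + do 2!eexists; split.
    * apply: exec_seq ex1 _; apply: exec_if; rewrite /= v1 h1; exact: ex2.
    * exact: v2.
    * by move=> x lt_x; rewrite k2 // k1.
    * rewrite /=; lia.
  + do 2!eexists; split.
    * apply: exec_seq ex1 _; apply: exec_if.
      rewrite /= v1 (negbTE h1); exact: ex3.
    * exact: v3.
    * by move=> x lt_x; rewrite k3 // k1.
    * rewrite /=; lia.
- case/andP=> w1 w2.
  have [t1 [s1 [ex1 v1 k1 le1]]] := IH1 _ _ _ _ _ ag hG w1.
  have ag1 : store_agrees (r :: m) r.+1 s1 (den env e1 :: env).
    by rewrite -v1; apply: store_agrees_cons; apply: store_agrees_le ag.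
  have hG1 : flagged_le N (small G e1 :: G) (den env e1 :: env).
    by apply: flagged_le_cons => //; exact: small_den.
  have [t2 [s2 [ex2 v2 k2 le2]]] := IH2 _ _ _ _ _ ag1 hG1 w2.
  do 2!eexists; split.
  + by apply: exec_seq ex1 _; apply: exec_seq ex2 _; exact: exec_assign.
  + by rewrite update_same.
  + by move=> x lt_x; rewrite update_lt // k2 ?k1 // ltnW.
  + rewrite /=; lia.
- case/and4P=> wl wi sl.
  set fl := small G i && _ => wb.
  have [t1 [s1 [ex1 v1 k1 le1]]] := IHi _ _ _ _ _ ag hG wi.
  have ag1 : store_agrees m r.+1 s1 env by apply: store_agrees_le ag.
  have [t2 [s2 [ex2 v2 k2 le2]]] := IHl _ _ _ _ _ ag1 hG wl.
  have ag2 : store_agrees m r s2 env.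
    by apply: store_agrees_le ag => // x lt_x; rewrite k2 ?k1 // ltnW.
  have hl : tree_size (den env l) <= N by exact: small_den hG sl.
  have hi : fl -> tree_size (den env i) <= N.
    by case/andP=> si _; exact: small_den hG si.
  set body := Seq (comp _ _ b) _.
  (* Induction on the remaining list, held in register [r.+1], for an arbitrary accumulator in [r].
     The size of the list as a tree bounds the number of iterations. *)
  have loop : forall u s2, tree_size u <= N -> s2 r.+1 = u ->
      (fl -> tree_size (s2 r) <= N) -> store_agrees m r s2 env ->
      exists t s', [/\ exec (While (EVar r.+1) body) s2 t s',
        s' r = tfold (fun u a => den [:: u, a & env] b) u (s2 r),
        forall x, x < r -> s' x = s2 x
        & t <= tree_size u * (pexp_time N b + 9) + 2].
    elim=> [|u1 _ u IHu] {hi ag ag1 ag2 ex1 ex2 v1 k1 v2 k2 s1 s2} s2 hu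
        vu hr ag.
      do 2!eexists; split; first by apply: exec_while_end; rewrite /= vu.
      - by [].
      - by [].
      - rewrite /=; lia.
    have agb : store_agrees [:: r.+1, r & m] r.+2 s2 [:: Node u1 u, s2 r & env].
      by rewrite -vu; do 2!apply: store_agrees_cons.
    have hGb : flagged_le N [:: true, fl & G] [:: Node u1 u, s2 r & env].
      by do 2!apply: flagged_le_cons => //.
    have [t3 [s3 [ex3 v3 k3 le3]]] := IHb _ _ _ _ _ agb hGb wb.
    set s4 := update (update s3 r (s3 r.+2)) r.+1
                     (eval (update s3 r (s3 r.+2)) (ETl (EVar r.+1))).
    have v4 : s4 r.+1 = u.
      rewrite /s4 update_same /= /update (gtn_eqF (ltnSn r)) k3 //.
      by rewrite vu.
    have v4r : s4 r = s3 r.+2 by rewrite /s4 update_lt // update_same.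
    have k4 x : x < r -> s4 x = s2 x.
      move=> lt_x; rewrite /s4 update_lt; last by lia.
      by rewrite update_lt // k3 //; lia.
    have hu' : tree_size u <= N by move: hu => /=; lia.
    have hr4 : fl -> tree_size (s4 r) <= N.
      rewrite v4r v3 => hfl; case/andP: (hfl) => _ sb.
      by apply: small_den sb => //; do 2!apply: flagged_le_cons => //; auto.
    have ag4 : store_agrees m r s4 env by apply: store_agrees_le ag.
    have [t5 [s5 [ex5 v5 k5 le5]]] := IHu s4 hu' v4 hr4 ag4.
    do 2!eexists; split.
    + apply: exec_while_loop ex5; first by rewrite /= vu.
      apply: exec_seq ex3 _; apply: exec_seq; first exact: exec_assign.
      exact: exec_assign.
    + by rewrite v5 v4r v3.
    + by move=> x lt_x; rewrite k5 // k4.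
    + by rewrite /=; have := tree_size_gt0 u1; nia.
  have [|t3 [s3 [ex3 v3 k3 le3]]] := loop _ s2 hl v2 _ ag2.
  + by move=> /hi; rewrite k2 // v1.
  do 2!eexists; split.
  + by apply: exec_seq ex1 _; apply: exec_seq ex2 _; exact: ex3.
  + by rewrite v3 k2 // v1.
  + by move=> x lt_x; rewrite k3 // k2 ?k1 // ltnW.
  + rewrite -/fl; nia.
Qed.

(** Degrees are added rather than maximized, so that the new power dominates each of the old ones; a
    fold raises the degree by one more for its N iterations. *)
Lemma pexp_time_poly e :
  exists a d, forall N, 0 < N -> pexp_time N e <= a * N ^ d.
Proof.
have pow N d d' : 0 < N -> N ^ d <= N ^ (d + d') /\ N ^ d' <= N ^ (d + d').
  by move=> N0; rewrite !leq_pexp2l // ?leq_addr ?leq_addl.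
elim: e => [i||e1 [a1 [d1 h1]] e2 [a2 [d2 h2]]|e1 [a1 [d1 h1]]|e1 [a1 [d1 h1]]
    |e1 [a1 [d1 h1]] e2 [a2 [d2 h2]] e3 [a3 [d3 h3]]
    |e1 [a1 [d1 h1]] e2 [a2 [d2 h2]]|l [a1 [d1 h1]] i [a2 [d2 h2]]
     b [a3 [d3 h3]]] /=.
- by exists 2, 0.
- by exists 2, 0.
- exists (a1 + a2 + 6), (d1 + d2) => N N0.
  have [p1 p2] := pow N d1 d2 N0; have := h1 N N0; have := h2 N N0.
  have : 0 < N ^ (d1 + d2) by rewrite expn_gt0 N0.
  by nia.
- exists (a1 + 4), d1 => N N0; have := h1 N N0.
  have : 0 < N ^ d1 by rewrite expn_gt0 N0.
  by nia.
- exists (a1 + 4), d1 => N N0; have := h1 N N0.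
  have : 0 < N ^ d1 by rewrite expn_gt0 N0.
  by nia.
- exists (a1 + a2 + a3 + 3), (d1 + d2 + d3) => N N0.
  have [p1 p2] := pow N d1 d2 N0; have [p12 p3] := pow N (d1 + d2) d3 N0.
  have := h1 N N0; have := h2 N N0; have := h3 N N0.
  have : 0 < N ^ (d1 + d2 + d3) by rewrite expn_gt0 N0.
  by nia.
- exists (a1 + a2 + 4), (d1 + d2) => N N0.
  have [p1 p2] := pow N d1 d2 N0; have := h1 N N0; have := h2 N N0.
  have : 0 < N ^ (d1 + d2) by rewrite expn_gt0 N0.
  by nia.
- exists (a1 + a2 + (a3 + 9) + 4), (d1 + d2 + d3).+1 => N N0.
  have [p1 p2] := pow N d1 d2 N0; have [p12 p3] := pow N (d1 + d2) d3 N0.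
  have := h1 N N0; have := h2 N N0; have := h3 N N0.
  have : 0 < N ^ (d1 + d2 + d3) by rewrite expn_gt0 N0.
  rewrite expnS; set Q := N ^ (d1 + d2 + d3) in p12 p3 * => Q0 i3 i2 i1.
  have j3 : pexp_time N b + 9 <= (a3 + 9) * Q by nia.
  have k3 : N * (pexp_time N b + 9) <= (a3 + 9) * (N * Q).
    by rewrite mulnCA leq_mul2l j3 orbT.
  have Q1 : Q <= N * Q by rewrite leq_pmull.
  have k1 : pexp_time N l <= a1 * (N * Q).
    by apply: leq_trans i1 _; rewrite leq_mul2l (leq_trans _ Q1) ?orbT //; lia.
  have k2 : pexp_time N i <= a2 * (N * Q).
    by apply: leq_trans i2 _; rewrite leq_mul2l (leq_trans _ Q1) ?orbT //; lia.
  by nia.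
Qed.

Definition main_cmd (e : pexp) : cmd :=
  Seq (comp [:: 0] 1 e) (Assign 0 (EVar 1)).

Lemma main_cmd_runs e : folds_small [:: true] e ->
  exists a d, forall u,
    runs_within (main_cmd e) u (den [:: u] e) (a * tree_size u ^ d).
Proof.
move=> he; have [a [d ht]] := pexp_time_poly e; exists (a + 3), d => u.
have u0 := tree_size_gt0 u.
have ag : store_agrees [:: 0] 1 (update (fun=> Leaf) 0 u) [:: u].
  by split=> // -[|i].
have hG : flagged_le (tree_size u) [:: true] [:: u] by case=> [|[|i]].
have [t [s' [ex v _ le_t]]] := comp_exec u0 ag hG he.
do 2!eexists; split; first by apply: exec_seq ex _; exact: exec_assign.
- by rewrite update_same.
- have : 0 < tree_size u ^ d by rewrite expn_gt0 u0.
  by have := ht _ u0; rewrite /=; nia.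
Qed.

(** * The testing strategy *)

Fixpoint sfold (T A : Type) (h : seq T -> A -> A) (s : seq T) (a : A) : A :=
  if s is _ :: s' then sfold h s' (h s a) else a.

Fixpoint suffix_find (T : Type) (P : pred T) (s : seq T) : seq T :=
  if s is x :: s' then if P x then s else suffix_find P s' else [::].

Lemma suffix_findP (T : eqType) (P : pred T) s : has P s ->
  exists x s', [/\ suffix_find P s = x :: s', P x & x \in s].
Proof.
elim: s => //= x s IH; case: ifP => [Px _|_ /IH[y [s' [-> Py ys]]]].
  by exists x, s; rewrite mem_head.
by exists y, s'; rewrite inE ys orbT.
Qed.

Lemma nilp_suffix_find (T : Type) (P : pred T) s :
  nilp (suffix_find P s) = ~~ has P s.
Proof. by elim: s => //= x s IH; case: (P x). Qed.

Definition dead (n : nat) (b : passign n) (t : seq 'I_n) : bool :=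
  has (fun v => b v == Some false) t.

Definition undecided (n : nat) (b : passign n) : pred 'I_n :=
  fun v => b v == None.

Definition satisfied (n : nat) (b : passign n) (f : dnf n) : bool :=
  has (fun t => ~~ dead b t && ~~ has (undecided b) t) f.

(** A candidate is kept as a suffix of the list: the empty list stands for no candidate, and in the
    program a suffix is a subtree of the input. *)
Definition sel_step (T : Type) (lt : rel T) (D : pred T) (s best : seq T) :
    seq T :=
  if s is t :: _ then
    if D t then best
    else if best is t' :: _ then if lt t t' then s else best else s
  else best.

(* The selected element is the head of the returned suffix of [s]. *)
Definition sel (T : Type) (lt : rel T) (D : pred T) (s : seq T) : seq T :=
  sfold (sel_step lt D) s [::].

Lemma eq_sel (T : Type) (lt : rel T) (D D' : pred T) s :
  D =1 D' -> sel lt D s = sel lt D' s.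
Proof.
move=> eqD; rewrite /sel; elim: s [::] => //= t s IH best.
by rewrite IH eqD.
Qed.

Local Open Scope ring_scope.

(** An approximate comparison of the maximal costs that computes neither maximum. *)
Definition term_lt (n : nat) (lt : rel rat) (c : 'I_n -> rat) :
    rel (seq 'I_n) :=
  fun t t' => has (fun v' => all (fun v => lt (c v) (c v')) t) t'.

Definition term_max (n : nat) (c : 'I_n -> rat) (t : seq 'I_n) : rat :=
  \big[Num.max/0]_(v <- t) c v.

(* The comparison [lt] only has to be right up to a factor 2. *)
Fixpoint dnf_strategy (n : nat) (lt : rel rat) (c : 'I_n -> rat) (f : dnf n)
    (fuel : nat) (b : passign n) : strategy n :=
  if satisfied b f then Output n true
  else if sel (term_lt lt c) (dead b) f is t :: _ then
    match suffix_find (undecided b) t, fuel with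
    | i :: _, fuel'.+1 =>
        Test i (dnf_strategy lt c f fuel' (learn b i false))
               (dnf_strategy lt c f fuel' (learn b i true))
    | _, _ => Output n false
    end
  else Output n false.

(** A rejected term has measure at least half that of the current candidate, and replacing the
    candidate never increases its measure. So the factor 2 does not accumulate over the scan. *)
Lemma sel_spec (T : eqType) (lt : rel T) (D : pred T) (M : T -> rat) s :
  (forall t t', lt t t' -> M t <= M t') ->
  (forall t t', 2 * M t < M t' -> lt t t') ->
  (forall t, 0 <= M t) ->
  match sel lt D s return Prop with
  | t0 :: _ =>
      [/\ t0 \in s, ~~ D t0 & forall t, t \in s -> ~~ D t -> M t0 <= 2 * M t]
  | [::] => all D s
  end.
Proof.
move=> ltM Mlt M0.
have gen best : (if best is t :: _ then ~~ D t else true) ->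
    match sfold (sel_step lt D) s best with
    | t0 :: _ =>
        [/\ ~~ D t0, if best is t1 :: _ then M t0 <= M t1 else true,
            (t0 \in s) || (sfold (sel_step lt D) s best == best)
          & forall t, t \in s -> ~~ D t -> M t0 <= 2 * M t]
    | [::] => all D s /\ best = [::]
    end.
  elim: s best => [|t s IH] [|t1 best] //= Db.
  - case: ifPn => Dt; have := IH [::] isT.
      case: (sfold _ _ _) => [|t0 l]; first by case=> ->.
      case=> D0 _ t0s ht; split=> //.
        by case/orP: t0s => [t0s|/eqP//]; rewrite inE t0s orbT.
      by move=> u; rewrite inE => /predU1P[->|/ht//]; rewrite Dt.
    have /(_ Dt) := IH (t :: s).
    case: (sfold _ _ _) => [|t0 l]; first by case.
    case=> D0 le0 t0s ht; split=> //.
      by case/orP: t0s => [t0s|/eqP[-> _]]; rewrite inE ?t0s ?eqxx ?orbT.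
    move=> u; rewrite inE => /predU1P[-> _|/ht//].
    by apply: le_trans le0 _; have := M0 t; lra.
  - case: ifPn => Dt.
      have /(_ Db) := IH (t1 :: best).
      case: (sfold _ _ _) => [|t0 l]; first by case.
      case=> D0 le0 t0s ht; split=> //.
        by case/orP: t0s => [t0s|->]; rewrite ?inE ?t0s ?orbT.
      by move=> u; rewrite inE => /predU1P[->|/ht//]; rewrite Dt.
    case: ifPn => ltt.
      have /(_ Dt) := IH (t :: s).
      case: (sfold _ _ _) => [|t0 l]; first by case.
      case=> D0 le0 t0s ht; split=> //.
      + by apply: le_trans le0 _; exact: ltM.
      + by case/orP: t0s => [t0s|/eqP[-> _]]; rewrite inE ?t0s ?eqxx ?orbT.
      + move=> u; rewrite inE => /predU1P[-> _|/ht//].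
        by apply: le_trans le0 _; have := M0 t; lra.
    have /(_ Db) := IH (t1 :: best).
    case: (sfold _ _ _) => [|t0 l]; first by case.
    case=> D0 le0 t0s ht; split=> //.
      by case/orP: t0s => [t0s|->]; rewrite ?inE ?t0s ?orbT.
    move=> u; rewrite inE => /predU1P[-> _|/ht//].
    apply: le_trans le0 _; rewrite leNgt; apply: contra ltt; exact: Mlt.
have := gen [::] isT; rewrite /sel; case: (sfold _ _ _) => [|t0 l].
  by case.
by case=> D0 _ t0s ht; split=> //; rewrite orbF in t0s.
Qed.

Lemma term_max_ge0 n (c : 'I_n -> rat) t :
  (forall i, 0 <= c i) -> 0 <= term_max c t.
Proof.
move=> c0; rewrite /term_max; elim/big_rec: _ => // i x _ x0.
by rewrite le_max x0 orbT.
Qed.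

Lemma le_term_max n (c : 'I_n -> rat) t v : v \in t -> c v <= term_max c t.
Proof.
rewrite /term_max; elim: t => //= w t IH; rewrite inE big_cons le_max.
by case/predU1P=> [->|/IH ->]; rewrite ?lexx ?orbT.
Qed.

Lemma term_max_le n (c : 'I_n -> rat) t m :
  0 <= m -> (forall v, v \in t -> c v <= m) -> term_max c t <= m.
Proof.
move=> m0 hm; rewrite /term_max big_seq; elim/big_rec: _ => // i x it xm.
by rewrite ge_max hm.
Qed.

Lemma term_lt_max n (lt : rel rat) (c : 'I_n -> rat) t t' :
  (forall i, 0 <= c i) ->
  (forall x y, 0 <= x -> 0 <= y -> lt x y -> x <= y) ->
  term_lt lt c t t' -> term_max c t <= term_max c t'.
Proof.
move=> c0 ltP /hasP[v' vt' /allP hv]; apply: term_max_le => [|v vt].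
  exact: term_max_ge0.
by apply: le_trans (le_term_max c vt'); apply: ltP => //; exact: hv.
Qed.

Lemma max_term_lt n (lt : rel rat) (c : 'I_n -> rat) t t' :
  (forall i, 0 <= c i) ->
  (forall x y, 0 <= x -> 0 <= y -> 2 * x < y -> lt x y) ->
  2 * term_max c t < term_max c t' -> term_lt lt c t t'.
Proof.
move=> c0 ltP; apply: contraTT; rewrite -leNgt => /hasPn nlt.
have M0 := term_max_ge0 t c0.
apply: term_max_le => [|v' /nlt /allPn[v vt nv]]; first by lra.
rewrite leNgt; apply: contra nv => lt_v; apply: ltP => //.
by apply: le_lt_trans lt_v; rewrite ler_pM2l // le_term_max.
Qed.

(** * Certificates *)

Lemma learnE n (b : passign n) i v j :
  learn b i v j = if j == i then Some v else b j.
Proof. by rewrite ffunE. Qed.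

(** A positive result falsifies no term, so it leaves the selected term unchanged. *)
Lemma dead_learn_true n (b : passign n) i t :
  b i = None -> dead (learn b i true) t = dead b t.
Proof.
move=> bi; apply: eq_has => v; rewrite learnE.
by case: (v =P i) => // ->; rewrite bi.
Qed.

Lemma containsP n (x : point n) (b : passign n) :
  reflect (forall i v, b i = Some v -> x i = v) (contains x b).
Proof.
apply: (iffP forallP) => [h i v bi|h i].
  by have := h i; rewrite bi /= => /eqP[].
by case bi: (b i) => [v|] //=; rewrite (h _ _ bi).
Qed.

Lemma all_alive n (x : point n) (b : passign n) t :
  contains x b -> all x t -> ~~ dead b t.
Proof.
move=> /containsP xb /allP xt; apply/hasPn => v /xt xv.
by apply/eqP => /xb; rewrite xv.
Qed.

Lemma satisfied_vcert n (f : dnf n) b : satisfied b f -> is_vcert f true b.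
Proof.
move=> /hasP[t tf /andP[/hasPn al /hasPn un]].
apply/forallP => a; apply/implyP => /containsP ab.
rewrite eqb_id; apply/hasP; exists t => //; apply/allP => v vt.
move: (al v vt) (un v vt); rewrite /undecided.
by case bv: (b v) => [[]|] //=; rewrite (ab _ _ bv).
Qed.

Lemma all_dead_vcert n (f : dnf n) b : all (dead b) f -> is_vcert f false b.
Proof.
move=> /allP hd; apply/forallP => a; apply/implyP => ab.
rewrite eqbF_neg; apply/hasPn => t /hd; apply: contraL => at_.
exact: all_alive ab at_.
Qed.

(** By monotonicity two completions of b suffice: ones in the open positions satisfy t, while zeros
    there satisfy only terms already satisfied by b. *)
Lemma undetermined n (f : dnf n) b t :
  t \in f -> ~~ dead b t -> ~~ satisfied b f -> ~~ is_cert f b.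
Proof.
move=> tf al ns; rewrite negb_or; apply/andP; split; apply/negP => /forallP h.
  pose a : point n := [ffun i => b i != Some false].
  have ab : contains a b.
    by apply/containsP => i v bi; rewrite ffunE bi; case: v {bi}.
  have := h a; rewrite ab /= eqbF_neg => /hasPn /(_ t tf) /negP; apply.
  by apply/allP => v vt; rewrite ffunE; exact: (hasPn al).
pose a : point n := [ffun i => b i == Some true].
have ab : contains a b.
  by apply/containsP => i v bi; rewrite ffunE bi; case: v {bi}.
have := h a; rewrite ab /= eqb_id => /hasP[u uf /allP au].
case/negP: ns; apply/hasP; exists u => //; apply/andP; split.
  by apply: all_alive ab _; apply/allP.
by apply/hasPn => v /au; rewrite ffunE /undecided => /eqP ->.
Qed.

Lemma CERT_ge0 n (f : dnf n) c x : (forall i, 0 <= c i) -> 0 <= CERT f c x.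
Proof.
move=> c0; rewrite /CERT; elim/big_rec: _ => [|b y _ y0].
  exact: sumr_ge0.
by rewrite le_min y0 sumr_ge0.
Qed.

(** A certificate contained in x must be a 1-certificate, and completing it by zeros shows that its
    ones include a whole term. As costs are nonnegative, it costs at least the dearest variable of
    that term. *)
Lemma CERT_ge n (f : dnf n) c x m :
  (forall i, 0 <= c i) -> dnf_eval f x ->
  (forall t, t \in f -> all x t -> m <= term_max c t) -> m <= CERT f c x.
Proof.
move=> c0 fx hm.
have sum_ge (P : pred 'I_n) t : (forall v, v \in t -> P v) ->
    term_max c t <= \sum_(j < n | P j) c j.
  move=> tP; apply: term_max_le => [|v /tP Pv]; first exact: sumr_ge0.
  by rewrite (bigD1 v) //= lerDl sumr_ge0.
rewrite /CERT; elim/big_rec: _ => [|b y /andP[cb xb] my].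
  (* The default value of the minimum, the cost of all variables. *)
  case/hasP: fx => t tf xt; apply: le_trans (hm t tf xt) _.
  exact: (sum_ge predT).
rewrite le_min my andbT.
have c1 : is_vcert f true b.
  by case/orP: cb => // /forallP/(_ x); rewrite xb fx.
pose a : point n := [ffun i => b i == Some true].
have ab : contains a b.
  by apply/containsP => i v bi; rewrite ffunE bi; case: v {bi}.
move/forallP: c1 => /(_ a); rewrite ab /= eqb_id => /hasP[t tf /allP at_].
have bt v : v \in t -> b v = Some true by move/at_; rewrite ffunE => /eqP.
apply: le_trans (hm t tf _) _.
  by apply/allP => v /bt bv; exact: (containsP _ _ xb).
by apply: (sum_ge (fun j => b j != None)) => v /bt ->.
Qed.

Definition open_count (n : nat) (b : passign n) : nat :=
  #|[pred i | undecided b i]|.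

Lemma open_count_learn n (b : passign n) i v :
  b i = None -> open_count b = (open_count (learn b i v)).+1.
Proof.
move=> bi; rewrite /open_count (cardD1 i) inE /undecided bi /= add1n.
congr _.+1.
by apply: eq_card => j; rewrite !inE /undecided learnE; case: (j =P i).
Qed.

(** The drop may exceed one, since a term may list a variable repeatedly. *)
Lemma count_undecided_learn n (b : passign n) i v t :
  b i = None -> i \in t ->
  (count (undecided (learn b i v)) t < count (undecided b) t)%N.
Proof.
move=> bi it; have -> : count (undecided b) t =
    (count (pred1 i) t + count (undecided (learn b i v)) t)%N.
  elim: t {it} => //= j t ->; rewrite addnACA; congr (_ + _)%N.
  by rewrite /undecided learnE; case: (j =P i) => [->|//]; rewrite bi.
by rewrite -[X in (X < _)%N]add0n ltn_add2r -has_count has_pred1.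
Qed.

Lemma dnf_strategy_evaluates n (lt : rel rat) (c : 'I_n -> rat) (f : dnf n)
    fuel b :
  (forall i, 0 <= c i) ->
  (forall x y, 0 <= x -> 0 <= y -> lt x y -> x <= y) ->
  (forall x y, 0 <= x -> 0 <= y -> 2 * x < y -> lt x y) ->
  (open_count b <= fuel)%N -> evaluates f b (dnf_strategy lt c f fuel b).
Proof.
move=> c0 lt1 lt2; elim: fuel b => [|fuel IH] b hb /=;
  case: ifPn => [/satisfied_vcert//|ns];
  have := sel_spec (dead b) f (fun t t' => term_lt_max c0 lt1)
    (fun t t' => max_term_lt c0 lt2) (fun t => term_max_ge0 t c0);
  case: (sel _ _ _) => [/all_dead_vcert//|t _] [tf al _];
  (* A live term without open variables would make b satisfy f. *)
  have un : has (undecided b) t;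
  try (by apply: contraNT ns => un; apply/hasP; exists t => //; rewrite al);
  have [i [s [-> /eqP bi _]]] := suffix_findP un.
  by move: hb; rewrite (open_count_learn true bi).
have oc v := open_count_learn v bi.
split=> //; first exact: undetermined tf al ns.
  by apply: IH; rewrite -ltnS -oc.
by apply: IH; rewrite -ltnS -oc.
Qed.

(** * Expected cost *)

(** Point masses at the known values give the conditional law without dividing by the probability of
    b. *)
Definition weight (n : nat) (p : 'I_n -> rat) (b : passign n) (i : 'I_n)
    (v : bool) : rat :=
  if b i is Some u then (u == v)%:R else if v then p i else 1 - p i.

(* Expectation conditional on the known values [b]. *)
Definition cexp (n : nat) (p : 'I_n -> rat) (b : passign n)
    (g : point n -> rat) : rat :=
  \sum_(x : point n) (\prod_(i < n) weight p b i (x i)) * g x.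

Lemma cexp_unknown n (p : 'I_n -> rat) g :
  cexp p (unknown n) g = expectation p g.
Proof.
apply: eq_bigr => x _; congr (_ * _); apply: eq_bigr => i _.
by rewrite /weight ffunE.
Qed.

Lemma weight_contains n (p : 'I_n -> rat) b (x : point n) :
  ~~ contains x b -> \prod_(i < n) weight p b i (x i) = 0.
Proof.
rewrite negb_forall => /existsP[i]; rewrite negb_or => /andP[bn bx].
rewrite (bigD1 i) //= /weight; case: (b i) bn bx => [u|] // _.
by rewrite (inj_eq Some_inj) => /negbTE ->; rewrite mul0r.
Qed.

Lemma eq_cexp n (p : 'I_n -> rat) b g g' :
  (forall x, contains x b -> g x = g' x) -> cexp p b g = cexp p b g'.
Proof.
move=> h; apply: eq_bigr => x _; case: (boolP (contains x b)) => [/h->//|xb].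
by rewrite weight_contains // !mul0r.
Qed.

Lemma le_cexp n (p : 'I_n -> rat) b g g' :
  (forall i, 0 < p i < 1) ->
  (forall x, contains x b -> g x <= g' x) -> cexp p b g <= cexp p b g'.
Proof.
move=> hp h; apply: ler_sum => x _.
case: (boolP (contains x b)) => [/h hx|xb]; last first.
  by rewrite weight_contains // !mul0r.
apply: ler_wpM2l hx; apply: prodr_ge0 => i _; rewrite /weight.
case/andP: (hp i) => p0 p1; case: (b i) => [u|]; first exact: ler0n.
by case: (x i); lra.
Qed.

Lemma cexp_cst n (p : 'I_n -> rat) b a : cexp p b (fun=> a) = a.
Proof.
rewrite /cexp -mulr_suml.
rewrite -(bigA_distr_bigA (fun i v => weight p b i v)) big1 ?mul1r // => i _.
rewrite big_bool /weight; case: (b i) => [[]|] /=; by [|ring].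
Qed.

Lemma cexpD n (p : 'I_n -> rat) b g g' :
  cexp p b (fun x => g x + g' x) = cexp p b g + cexp p b g'.
Proof. by rewrite /cexp -big_split; apply: eq_bigr => x _; rewrite mulrDr. Qed.

Lemma cexp_learn n (p : 'I_n -> rat) (b : passign n) i g : b i = None ->
  cexp p b g =
    p i * cexp p (learn b i true) g + (1 - p i) * cexp p (learn b i false) g.
Proof.
move=> bi; rewrite /cexp !mulr_sumr -big_split; apply: eq_bigr => x _ /=.
have rest v : \prod_(j < n | j != i) weight p (learn b i v) j (x j) =
    \prod_(j < n | j != i) weight p b j (x j).
  by apply: eq_bigr => j ji; rewrite /weight learnE (negbTE ji).
rewrite (bigD1 i) // [in X in _ = X + _](bigD1 i) //.
rewrite [in X in _ = _ + X](bigD1 i) //= !rest /weight !learnE eqxx bi.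
by case: (x i) => /=; ring.
Qed.

Lemma cexp_Test n (p c : 'I_n -> rat) (b : passign n) i S0 S1 : b i = None ->
  cexp p b (strategy_cost c (Test i S0 S1)) =
    c i + p i * cexp p (learn b i true) (strategy_cost c S1)
        + (1 - p i) * cexp p (learn b i false) (strategy_cost c S0).
Proof.
move=> bi; rewrite /= cexpD cexp_cst -addrA; congr (_ + _).
rewrite (cexp_learn _ _ bi); congr (_ * _ + _ * _); apply: eq_cexp => x.
  by move=> /containsP/(_ i true) -> //; rewrite learnE eqxx.
by move=> /containsP/(_ i false) -> //; rewrite learnE eqxx.
Qed.

Lemma rho_le n (p : 'I_n -> rat) i : rho p <= p i /\ rho p <= 1 - p i.
Proof.
rewrite /rho (bigD1 i) //=; split; rewrite !ge_min lexx ?orbT //.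
Qed.

Lemma rho_gt0 n (p : 'I_n -> rat) : (forall i, 0 < p i < 1) -> 0 < rho p.
Proof.
move=> hp; rewrite /rho; elim/big_rec: _ => // i x _ x0.
by case/andP: (hp i) => p0 p1; rewrite !lt_min p0 x0 subr_gt0 p1.
Qed.

(* [y = rho ^- k] and [z = rho ^+ (r - 1)] for [r] the number of untested
   variables of the selected term.  The surplus [2 * M * (y * (rho * z) - 1)] of
   the bound over the expected cost is nonnegative because [r <= k].  It grows
   when the tested variable is 1, is lost when that variable is 0, and on average
   grows by the cost of the test at least. *)
Lemma potential_step (p rh y z M ci G G1 G0 V1 V0 : rat) :
  0 < rh -> rh <= p -> rh <= 1 - p -> 0 <= ci <= M -> 1 <= y * z ->
  G = p * G1 + (1 - p) * G0 ->
  V1 <= 4 * y * G1 - 2 * M * (y * z - 1) -> V0 <= 4 * y * G0 ->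
  ci + p * V1 + (1 - p) * V0 <= 4 * y * G - 2 * M * (y * (rh * z) - 1).
Proof.
move=> rh0 rhp rhq /andP[ci0 ciM] yz -> h1 h0.
have M0 : 0 <= M by apply: le_trans ciM.
have {h1} h1 : p * V1 <= p * (4 * y * G1 - 2 * M * (y * z - 1)).
  by apply: ler_wpM2l => //; lra.
have {h0} h0 : (1 - p) * V0 <= (1 - p) * (4 * y * G0).
  by apply: ler_wpM2l => //; lra.
have h2 : rh * (M * (y * z - 1)) <= p * (M * (y * z - 1)).
  by apply: ler_wpM2r => //; apply: mulr_ge0 => //; lra.
(* As p and 1 - p are both at least rh, rh is at most 1/2. This loss and the test cost [ci <= M]
   together use up the 2 * M in the goal. *)
have h3 : 2 * rh * M <= M.
  by rewrite -[leRHS]mul1r; apply: ler_wpM2r => //; lra.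
lra.
Qed.

(** Induction on the fuel, for the bound sharpened by the surplus of the selected term. The surplus
    is carried along while tests yield 1, given up after a 0, and paid for by the certificate cost
    once a term is satisfied. *)
Lemma dnf_strategy_cost n k (lt : rel rat) (p c : 'I_n -> rat) (f : dnf n)
    fuel b :
  is_kdnf k f -> (forall i, 0 < p i < 1) -> (forall i, 0 <= c i) ->
  (forall x y, 0 <= x -> 0 <= y -> lt x y -> x <= y) ->
  (forall x y, 0 <= x -> 0 <= y -> 2 * x < y -> lt x y) ->
  (open_count b <= fuel)%N ->
  cexp p b (strategy_cost c (dnf_strategy lt c f fuel b))
    <= 4 / rho p ^+ k * cexp p b (CERT f c).
Proof.
move=> /allP fk hp c0 lt1 lt2.
set y := (rho p ^+ k)^-1; set G := fun b => cexp p b (CERT f c).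
have rh0 := rho_gt0 hp.
have y0 : 0 < y by rewrite invr_gt0 exprn_gt0.
have G0 b' : 0 <= G b'.
  by rewrite -(cexp_cst p b' 0); apply: le_cexp => // x _; exact: CERT_ge0.
have rh1 : rho p <= 1.
  rewrite /rho; elim/big_rec: _ => // i x _ x1; by rewrite ge_min x1 orbT.
have yge (r : nat) : (r <= k)%N -> 1 <= y * rho p ^+ r.
  move=> rk; rewrite /y mulrC ler_pdivlMr ?exprn_gt0 // mul1r.
  by rewrite ler_wiXn2l // ltW.
pose V fuel b := cexp p b (strategy_cost c (dnf_strategy lt c f fuel b)).
have base b' v : cexp p b' (strategy_cost c (Output n v)) = 0.
  exact: cexp_cst.
pose refined fuel b := match sel (term_lt lt c) (dead b) f return Prop with
  | t :: _ => V fuel b <= 4 * y * G b -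
      2 * term_max c t * (y * rho p ^+ count (undecided b) t - 1)
  | [::] => V fuel b <= 4 * y * G b
  end.
have sel_b b' := sel_spec (dead b') f (fun t t' => term_lt_max c0 lt1)
    (fun t t' => max_term_lt c0 lt2) (fun t => term_max_ge0 t c0).
have weaken fuel' b' : refined fuel' b' -> V fuel' b' <= 4 * y * G b'.
  rewrite /refined; have := sel_b b'.
  case: (sel _ _ _) => // t _ [tf _ _] /le_trans; apply.
  rewrite gerBl; apply: mulr_ge0.
    by apply: mulr_ge0 => //; exact: term_max_ge0.
  by rewrite subr_ge0 yge // (leq_trans (count_size _ _)) // fk.
move=> ob; apply: (weaken).
(* No test remains, so 4 * y * G alone covers the surplus: G is at least M / 2. The constant 4 is
   the 2 of the surplus times the 2 of the approximate order. *)
have sat fuel' b' : satisfied b' f -> refined fuel' b'.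
  move=> sb; have V0 : V fuel' b' = 0.
    by rewrite /V; case: fuel' => [|fuel'] /=; rewrite sb base.
  rewrite /refined V0; have := sel_b b'.
  have Ky : 0 <= 4 * y by rewrite mulr_ge0 // ltW.
  case: (sel _ _ _) => [_|t _ [tf _ tM]]; first by rewrite mulr_ge0.
  (* Terms satisfied by x are not dead, so the maximal cost of each is at least half that of the
     selected term. *)
  have half : term_max c t / 2 <= G b'.
    rewrite -(cexp_cst p b' (term_max c t / 2)); apply: le_cexp => // x xb.
    apply: CERT_ge => // [|u uf xu].
      by move/forallP: (satisfied_vcert sb) => /(_ x); rewrite xb /= eqb_id.
    by rewrite ler_pdivrMr // mulrC; apply: tM => //; exact: all_alive xu.
  have M0 := term_max_ge0 t c0.
  have r1 : rho p ^+ count (undecided b') t <= 1 by rewrite exprn_ile1 // ltW.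
  have : 0 <= 4 * y * (G b' - term_max c t / 2).
    by rewrite mulr_ge0 // subr_ge0.
  have : 0 <= 2 * term_max c t * y * (1 - rho p ^+ count (undecided b') t).
    by rewrite mulr_ge0 ?subr_ge0 // mulr_ge0 ?mulr_ge0 // ltW.
  lra.
elim: fuel b ob => [|fuel IH] b ob;
  (case: (boolP (satisfied b f)) => [|ns]; first exact: sat);
  rewrite /refined /V /= (negbTE ns); have := sel_b b;
  case Esel: (sel _ _ _) => [|t u];
  try by (move=> _; rewrite base mulr_ge0 // mulr_ge0 // ltW).
all: case=> [tf al tM];
  (have un : has (undecided b) t
    by apply: contraNT ns => un; apply/hasP; exists t => //; rewrite al);
  have [i [s [-> /eqP bi it]]] := suffix_findP un.
  by move: ob; rewrite (open_count_learn true bi).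
have oc v : (open_count (learn b i v) <= fuel)%N.
  by rewrite -ltnS -(open_count_learn v bi).
rewrite (cexp_Test _ _ _ _ bi).
have := IH _ (oc true); rewrite /refined.
have <- : sel (term_lt lt c) (dead b) f =
          sel (term_lt lt c) (dead (learn b i true)) f.
  by apply: eq_sel => v; rewrite dead_learn_true.
rewrite Esel => V1.
(* After a 0 the term t is dead and another one may be selected, so only the bound without surplus
   is used. *)
have /weaken V0 := IH _ (oc false).
have [rhp rhq] := rho_le p i.
set z := rho p ^+ (count (undecided b) t).-1.
have cnt : (count (undecided (learn b i true)) t < count (undecided b) t)%N.
  exact: count_undecided_learn.
have -> : rho p ^+ count (undecided b) t = rho p * z.
  by rewrite -exprS prednK // (leq_ltn_trans _ cnt).
apply: (@potential_step _ (rho p) y z (term_max c t) _ _ _ _ _ _ rh0 rhp rhq).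
- by rewrite c0 le_term_max.
- apply: yge; apply: leq_trans (leq_pred _) _.
  by apply: leq_trans (count_size _ _) _; exact: fk.
- exact: cexp_learn bi.
- apply: le_trans V1 _; rewrite lerD2l lerN2.
  apply: ler_wpM2l; first by rewrite mulr_ge0 // term_max_ge0.
  rewrite lerD2r; apply: ler_wpM2l; first exact: ltW.
  (* If more than one occurrence is decided by the test, the surplus only increases. *)
  apply: ler_wiXn2l => //; first exact: ltW.
  by rewrite -ltnS prednK // (leq_ltn_trans _ cnt).
- exact: V0.
Qed.

(** * Comparing rationals *)

Local Open Scope nat_scope.

Fixpoint bits_val (s : seq bool) : nat :=
  if s is b :: s' then b + (bits_val s').*2 else 0.

(* No leading zeros, the most significant bit being the last one. *)
Definition normal_bits (s : seq bool) : bool := last true s.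

Lemma bits_val_drop j s : bits_val (drop j s) = bits_val s %/ 2 ^ j.
Proof.
elim: s j => [|b s IH] [|j] //=; rewrite ?div0n ?divn1 // IH expnS divnMA.
by congr (_ %/ _); case: b => /=; lia.
Qed.

Lemma bits_val_gt0 s : normal_bits s -> s != [::] -> 0 < bits_val s.
Proof.
rewrite /normal_bits; elim: s => //= b [|b' s] IH /= hl _.
  by rewrite hl.
by rewrite addn_gt0 double_gt0 IH ?orbT.
Qed.

Lemma bits_val_lt s : bits_val s < 2 ^ size s.
Proof. by elim: s => //= b s IH; rewrite expnS mul2n; case: b; lia. Qed.

Lemma nat_bitsK m : bits_val (nat_bits m) = m.
Proof.
rewrite -{2}(bin_of_natK m) /nat_bits; case: (bin_of_nat m) => //= q.
elim: q => //= q ->; lia.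
Qed.

Lemma nat_bits_normal m : normal_bits (nat_bits m).
Proof.
have pos q x : last x (pos_bits q) by elim: q x => //= q IH x; exact: IH.
by rewrite /normal_bits /nat_bits; case: (bin_of_nat m) => //= q; exact: pos.
Qed.

Lemma size_nat_bits_gt j m : 2 ^ j <= m -> j < size (nat_bits m).
Proof.
move=> hj; rewrite -(ltn_exp2l j _ (isT : 1 < 2)); apply: leq_ltn_trans hj _.
by rewrite -{1}(nat_bitsK m) bits_val_lt.
Qed.

(* Compares a / b with c / d up to a factor 2 by looking for a power of 2
   between them; dividing by [2 ^ j] just drops bits. *)
Definition frac_lt (a b c d : nat) : bool :=
  has (fun j => (a %/ 2 ^ j < b) && (d <= c %/ 2 ^ j))
      (iota 0 (size (nat_bits c)))
  || has (fun j => (a <= b %/ 2 ^ j) && (d %/ 2 ^ j < c))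
         (iota 1 (size (nat_bits d))).

Lemma frac_lt_le a b c d : 0 < d -> frac_lt a b c d -> a * d <= c * b.
Proof.
move=> d0 /orP[] /hasP[j _]; rewrite ?ltn_divLR ?leq_divRL ?expn_gt0 //.
  by case/andP=> h1 h2; set q := 2 ^ j in h1 h2; nia.
by case/andP=> h1 h2; set q := 2 ^ j in h1 h2; nia.
Qed.

Lemma dyadic_quotient c d : 0 < d <= c ->
  exists j, 2 ^ j * d <= c < 2 ^ j.+1 * d.
Proof.
case/andP=> d0 dc; exists (trunc_log 2 (c %/ d)).
rewrite -leq_divRL // -ltn_divLR //.
by apply: trunc_log_bounds; rewrite ?divn_gt0.
Qed.

(** If c / d is at least 1, rounding it down to a power of 2 loses less than a factor 2 and so stays
    above a / b. Otherwise d / c is bracketed by [2 ^ j] and [2 ^ j.+1], and the inverse of the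
    latter separates the fractions. *)
Lemma frac_double_lt a b c d : 0 < b -> 0 < d ->
  2 * (a * d) < c * b -> frac_lt a b c d.
Proof.
move=> b0 d0 lt2; have c0 : 0 < c by case: c lt2.
have bits j u v : 0 < u -> 2 ^ j * u <= v -> j < size (nat_bits v).
  move=> u0 hj; apply: size_nat_bits_gt; apply: leq_trans hj.
  by rewrite leq_pmulr.
rewrite /frac_lt; case: (leqP d c) => [dc|/ltnW cd]; apply/orP.
  have [j /andP[h1 h2]] := dyadic_quotient (introT andP (conj d0 dc)).
  left; apply/hasP; exists j; first by rewrite mem_iota add0n (bits _ d).
  rewrite ltn_divLR ?leq_divRL ?expn_gt0 // [d * _]mulnC h1 andbT.
  move: h2; rewrite expnS; set q := 2 ^ j in h1 * => h2; nia.
have [j /andP[h1 h2]] := dyadic_quotient (introT andP (conj c0 cd)).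
(* Getting strictly below c / d takes the exponent [j.+1], which is why the second range in
   [frac_lt] starts at 1. *)
right; apply/hasP; exists j.+1.
  by rewrite mem_iota add1n /= ltnS (bits _ c).
rewrite ltn_divLR ?leq_divRL ?expn_gt0 // [c * _]mulnC h2 andbT.
rewrite expnS; set q := 2 ^ j in h1 *; nia.
Qed.

Definition rat_lt (x y : rat) : bool :=
  frac_lt `|numq x| `|denq x| `|numq y| `|denq y|.

Local Open Scope ring_scope.

Lemma ge0_numden (x : rat) : 0 <= x ->
  (0 < `|denq x|)%N /\ x * `|denq x|%:R = `|numq x|%:R.
Proof.
move=> x0; split; first by rewrite absz_gt0 denq_neq0.
have n0 : 0 <= numq x by rewrite numq_ge0.
rewrite !natr_absz gtr0_norm ?denq_gt0 // ger0_norm //.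
by rewrite -{1}(divq_num_den x) divfK // intr_eq0 denq_neq0.
Qed.

Lemma rat_lt_le x y : 0 <= x -> 0 <= y -> rat_lt x y -> x <= y.
Proof.
move=> /ge0_numden[b0 hx] /ge0_numden[d0 hy] /(frac_lt_le d0) h.
have B : (0 : rat) < `|denq x|%:R by rewrite ltr0n.
have D : (0 : rat) < `|denq y|%:R by rewrite ltr0n.
move: h; rewrite -(ler_nat rat) !natrM -hx -hy mulrAC -!mulrA.
by rewrite ler_pM2r // mulr_gt0.
Qed.

Lemma rat_double_lt x y : 0 <= x -> 0 <= y -> 2 * x < y -> rat_lt x y.
Proof.
move=> /ge0_numden[b0 hx] /ge0_numden[d0 hy] h; apply: frac_double_lt => //.
have B : (0 : rat) < `|denq x|%:R by rewrite ltr0n.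
have D : (0 : rat) < `|denq y|%:R by rewrite ltr0n.
rewrite -(ltr_nat rat) !natrM -hx -hy.
set b := `|denq x|%:R in B *; set d := `|denq y|%:R in D *.
have -> : 2%:R * (x * b * d) = 2 * x * (b * d) by ring.
have -> : y * d * b = y * (b * d) by ring.
by rewrite ltr_pM2r // mulr_gt0.
Qed.

(** * The program *)

Local Open Scope nat_scope.

Definition PTrue : pexp := PNode PLeaf PLeaf.
Definition pnot (e : pexp) : pexp := PIf e PLeaf PTrue.
Definition por (e1 e2 : pexp) : pexp := PIf e1 PTrue e2.
Definition pand (e1 e2 : pexp) : pexp := PIf e1 e2 PLeaf.

(** Unary numbers being lists, this one operation serves to index the costs, to compare variables
    and to divide by powers of 2. *)
Definition pdrop (j l : pexp) : pexp := PFold j l (PTl (PVar 1)).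

(* The state of the fold is the comparison of the bits seen so far, followed by
   the remaining bits of [v]. *)
Definition pltb (u v : pexp) : pexp :=
  PLet (PFold u (PNode PLeaf v)
          (PNode (PIf (PHd (PTl (PVar 1)))
                      (PIf (PHd (PVar 0)) (PHd (PVar 1)) PTrue)
                      (PIf (PHd (PVar 0)) PLeaf (PHd (PVar 1))))
                 (PTl (PTl (PVar 1)))))
       (por (PTl (PVar 0)) (PHd (PVar 0))).

(* Compares the rationals in variables 0 and 1. *)
Definition prat_lt : pexp :=
  let a := PHd (PVar 2) in let b := PTl (PVar 2) in
  let c := PHd (PVar 3) in let d := PTl (PVar 3) in
  por (PFold (PHd (PVar 1)) PLeaf
         (por (PVar 1)
              (pand (pltb (pdrop (PTl (PVar 0)) a) b)
                    (pnot (pltb (pdrop (PTl (PVar 0)) c) d)))))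
      (PFold (PTl (PVar 1)) PLeaf
         (por (PVar 1)
              (pand (pnot (pltb (pdrop (PVar 0) b) a))
                    (pltb (pdrop (PVar 0) d) c)))).

(* From here on, [k] is the index of the variable that holds the input. *)
Definition pterms (k : nat) : pexp := PHd (PHd (PVar k)).
Definition pcosts (k : nat) : pexp := PTl (PTl (PHd (PVar k))).
Definition phistory (k : nat) : pexp := PTl (PVar k).

Definition pcost (k : nat) (v : pexp) : pexp := PHd (pdrop v (pcosts k)).

Definition pvar_le (u v : pexp) : pexp := pnot (pdrop v u).
Definition pvar_eq (u v : pexp) : pexp := pand (pvar_le u v) (pvar_le v u).

(** The whole entry is returned, because the bare result 0 is [Leaf] and could not be told from a
    missing entry. *)
Definition plookup (k i : nat) : pexp :=
  PFold (phistory k) PLeaf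
    (PIf (pvar_eq (PHd (PHd (PVar 0))) (PVar i.+2)) (PHd (PVar 0)) (PVar 1)).

Definition pdead (k i : nat) : pexp :=
  PFold (PVar i) PLeaf
    (PLet (PHd (PVar 0))
       (PLet (plookup k.+3 0)
          (por (PVar 3) (pand (PVar 0) (pnot (PTl (PVar 0))))))).

Definition pfind_undecided (k i : nat) : pexp :=
  PFold (PVar i) PLeaf
    (PIf (PVar 1) (PVar 1)
       (PLet (PHd (PVar 0)) (PIf (plookup k.+3 0) (PVar 2) (PVar 1)))).

(* Compares the terms in variables 0 and 1. *)
Definition pterm_lt (k : nat) : pexp :=
  PFold (PVar 1) PLeaf
    (por (PVar 1)
       (PFold (PVar 2) PTrue
          (pand (PVar 1)
             (PLet (pcost k.+4 (PHd (PVar 2)))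
                (PLet (pcost k.+4.+1 (PHd (PVar 1))) prat_lt))))).

Definition psatisfied : pexp :=
  PFold (pterms 0) PLeaf
    (PLet (PHd (PVar 0))
       (por (PVar 2) (pand (pnot (pdead 3 0)) (pnot (pfind_undecided 3 0))))).

Definition psel : pexp :=
  PFold (pterms 0) PLeaf
    (PLet (PHd (PVar 0))
       (PIf (pdead 3 0) (PVar 2)
          (PIf (PVar 2)
             (PLet (PHd (PVar 2))
                (PLet (PVar 1) (PIf (pterm_lt 5) (PVar 3) (PVar 4))))
             (PVar 1)))).

Definition pmain : pexp :=
  PIf psatisfied (PNode PLeaf PTrue)
    (PLet psel
       (PIf (PVar 0)
          (PLet (PHd (PVar 0))
             (PNode PTrue (PHd (pfind_undecided 2 0))))
          (PNode PLeaf PLeaf))).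

(** With [main_cmd_runs], this check by computation makes the program polynomial in the size of its
    input. *)
Lemma pmain_folds_small : folds_small [:: true] pmain.
Proof. by []. Qed.

(** * Correctness of the program *)

Lemma truthy_enc_bool v : truthy (enc_bool v) = v.
Proof. by case: v. Qed.

Lemma tfold_enc (T A : Type) (enc : T -> tree) (E : A -> tree) g h s a :
  (forall x s a, g (enc_seq enc (x :: s)) (E a) = E (h (x :: s) a)) ->
  tfold g (enc_seq enc s) (E a) = E (sfold h s a).
Proof. by move=> gh; elim: s a => //= x s IH a; rewrite -IH -gh. Qed.

Lemma sfold_has (T : Type) (P : pred T) s v :
  sfold (fun u a => a || (if u is x :: _ then P x else false)) s v
    = v || has P s.
Proof. by elim: s v => [|x s IH] v /=; rewrite ?orbF // IH orbA. Qed.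

Lemma sfold_all (T : Type) (P : pred T) s v :
  sfold (fun u a => a && (if u is x :: _ then P x else true)) s v
    = v && all P s.
Proof. by elim: s v => [|x s IH] v /=; rewrite ?andbT // IH andbA. Qed.

(** The suffixes of s supply the exponents in unary, in decreasing order down to 0. *)
Lemma sfold_has_size (T : Type) (P : pred nat) (s : seq T) v :
  sfold (fun u a => a || P (size u).-1) s v = v || has P (iota 0 (size s)).
Proof.
elim: s v => [|x s IH] v; first by rewrite orbF.
rewrite [size _]/= -addn1 iotaD has_cat add0n /= IH orbF.
by rewrite -orbA [has _ _ || _]orbC.
Qed.

Lemma den_fold (T A : Type) (enc : T -> tree) (E : A -> tree) env l i b h s a :
  den env l = enc_seq enc s -> den env i = E a ->
  (forall x s a,
    den [:: enc_seq enc (x :: s), E a & env] b = E (h (x :: s) a)) ->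
  den env (PFold l i b) = E (sfold h s a).
Proof. by move=> hl hi hb; rewrite /= hl hi; apply: tfold_enc. Qed.

Lemma den_fold_has (T : Type) (enc : T -> tree) (P : pred T) env l b s :
  den env l = enc_seq enc s ->
  (forall x s v,
    den [:: enc_seq enc (x :: s), enc_bool v & env] b = enc_bool (v || P x)) ->
  den env (PFold l PLeaf b) = enc_bool (has P s).
Proof.
move=> hl hb; rewrite -[has P s]/(false || has P s) -sfold_has.
exact: den_fold hl _ hb.
Qed.

Lemma den_fold_all (T : Type) (enc : T -> tree) (P : pred T) env l b s :
  den env l = enc_seq enc s ->
  (forall x s v,
    den [:: enc_seq enc (x :: s), enc_bool v & env] b = enc_bool (v && P x)) ->
  den env (PFold l PTrue b) = enc_bool (all P s).
Proof.
move=> hl hb; rewrite -[all P s]/(true && all P s) -sfold_all.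
exact: den_fold hl _ hb.
Qed.

Lemma den_fold_has_size (T : Type) (enc : T -> tree) (P : pred nat) env l b s :
  den env l = enc_seq enc s ->
  (forall x s v, den [:: enc_seq enc (x :: s), enc_bool v & env] b =
     enc_bool (v || P (size s))) ->
  den env (PFold l PLeaf b) = enc_bool (has P (iota 0 (size s))).
Proof.
move=> hl hb; rewrite -[has P _]/(false || has P _) -sfold_has_size.
exact: den_fold hl _ hb.
Qed.

Section EvalCombinators.

Variables (env : seq tree) (e1 e2 : pexp) (v1 v2 : bool).
Hypotheses (h1 : den env e1 = enc_bool v1) (h2 : den env e2 = enc_bool v2).

Lemma den_pnot : den env (pnot e1) = enc_bool (~~ v1).
Proof. by rewrite /= h1; case: v1. Qed.

Lemma den_por : den env (por e1 e2) = enc_bool (v1 || v2).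
Proof. by rewrite /= h1 h2; case: v1. Qed.

Lemma den_pand : den env (pand e1 e2) = enc_bool (v1 && v2).
Proof. by rewrite /= h1 h2; case: v1. Qed.

End EvalCombinators.

Lemma den_pdrop (T T' : Type) (enc : T -> tree) (enc' : T' -> tree)
    env j l s s' :
  den env j = enc_seq enc s -> den env l = enc_seq enc' s' ->
  den env (pdrop j l) = enc_seq enc' (drop (size s) s').
Proof.
move=> /= -> ->; elim: s s' => [|x s IH] s' /=; first by rewrite drop0.
by case: s' => [|y s'] /=; [exact: (IH [::]) | exact: IH].
Qed.

Definition cmp_step (u a : tree) : tree :=
  Node (if truthy (hd (tl a))
        then if truthy (hd u) then hd a else Node Leaf Leaf
        else if truthy (hd u) then Leaf else hd a)
       (tl (tl a)).

Definition cmp_result (a : tree) : tree :=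
  if truthy (tl a) then Node Leaf Leaf else hd a.

(** Bits come least significant first, so a later difference overrides the verdict [r] on the lower
    bits, which counts only on a tie. Bits of s' left over at the end make it the larger number,
    because the last of them is 1. *)
Lemma tfold_cmp s s' r : normal_bits s' ->
  cmp_result (tfold cmp_step (enc_seq enc_bool s)
                (Node (enc_bool r) (enc_seq enc_bool s'))) =
    enc_bool ((bits_val s < bits_val s') || (bits_val s == bits_val s') && r).
Proof.
elim: s s' r => [|b s IH] [|b' s'] r ns'.
- by case: r.
- by have /= -> := bits_val_gt0 ns' isT.
- have -> : tfold cmp_step (enc_seq enc_bool (b :: s))
              (Node (enc_bool r) (enc_seq enc_bool [::])) =
            tfold cmp_step (enc_seq enc_bool s)
              (Node (enc_bool (~~ b && r)) (enc_seq enc_bool [::])).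
    by case: b.
  by rewrite IH //=; congr enc_bool; case: b => /=; lia.
- have -> : tfold cmp_step (enc_seq enc_bool (b :: s))
              (Node (enc_bool r) (enc_seq enc_bool (b' :: s'))) =
            tfold cmp_step (enc_seq enc_bool s)
              (Node (enc_bool (if b == b' then r else b'))
                    (enc_seq enc_bool s')).
    by case: b; case: (b').
  have ns : normal_bits s' by move: ns'; rewrite /normal_bits /=; case: (s').
  rewrite IH //=; clear ns'; congr enc_bool; case: b; case: b' => /=; lia.
Qed.

Lemma den_pltb env u v s s' :
  den env u = enc_seq enc_bool s -> den env v = enc_seq enc_bool s' ->
  normal_bits s' -> den env (pltb u v) = enc_bool (bits_val s < bits_val s').
Proof.
move=> hu hv ns'; have := tfold_cmp s false ns'; rewrite andbF orbF => <-.
by rewrite /= hu hv.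
Qed.

Lemma den_pltb_drop env u v j m m' (T : Type) (enc : T -> tree) (s : seq T) :
  den env j = enc_seq enc s ->
  den env u = enc_nat m -> den env v = enc_nat m' ->
  den env (pltb (pdrop j u) v) = enc_bool (m %/ 2 ^ size s < m').
Proof.
move=> hj hu hv; rewrite -[m in RHS]nat_bitsK -[m' in RHS]nat_bitsK.
rewrite -bits_val_drop.
by apply: den_pltb (nat_bits_normal m') => //; exact: den_pdrop hj hu.
Qed.

Lemma den_prat_lt x y env :
  den [:: enc_rat x, enc_rat y & env] prat_lt = enc_bool (rat_lt x y).
Proof.
rewrite /prat_lt /rat_lt /frac_lt; apply: den_por.
  apply: (den_fold_has_size (enc := enc_bool)) => // v0 s v.
  apply: den_por => //.
  apply: den_pand; last rewrite leqNgt; last apply: den_pnot.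
    exact: (den_pltb_drop (enc := enc_bool)).
  exact: (den_pltb_drop (enc := enc_bool)).
(* Exponents start at 1 here, matching the length of the suffix itself instead of its tail. *)
rewrite -[1]/(1 + 0) iotaDl has_map.
apply: (den_fold_has_size (enc := enc_bool)) => // v0 s v.
apply: den_por => //.
apply: den_pand; first rewrite leqNgt; first apply: den_pnot.
  exact: (den_pltb_drop (enc := enc_bool) (s := v0 :: s)).
exact: (den_pltb_drop (enc := enc_bool) (s := v0 :: s)).
Qed.

Lemma truthy_enc_seq (T : Type) (enc : T -> tree) s :
  truthy (enc_seq enc s) = ~~ nilp s.
Proof. by case: s. Qed.

Lemma den_PIf env e1 e2 e3 : den env (PIf e1 e2 e3) =
  if truthy (den env e1) then den env e2 else den env e3.
Proof. by []. Qed.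

Lemma den_PLet env e1 e2 :
  den env (PLet e1 e2) = den (den env e1 :: env) e2.
Proof. by []. Qed.

Lemma enc_varE n (i : 'I_n) : enc_var i = enc_seq (fun=> Leaf) (nseq i tt).
Proof. by rewrite /enc_var; elim: (i : nat) => //= m ->. Qed.

Lemma den_pvar_eq n (i j : 'I_n) env u v :
  den env u = enc_var i -> den env v = enc_var j ->
  den env (pvar_eq u v) = enc_bool (i == j).
Proof.
have le w w' (a b : 'I_n) : den env w = enc_var a -> den env w' = enc_var b ->
    den env (pvar_le w w') = enc_bool (a <= b).
  rewrite !enc_varE => ha hb; rewrite /pvar_le den_PIf.
  rewrite (den_pdrop hb ha) truthy_enc_seq drop_nseq size_nseq.
  by rewrite /nilp size_nseq -subn_eq0; case: (a - b).
move=> hu hv; rewrite -val_eqE eqn_leq.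
by apply: den_pand; exact: le.
Qed.

Definition known (n : nat) (h : seq ('I_n * bool)) : passign n :=
  foldl (fun b iv => learn b iv.1 iv.2) (unknown n) h.

Definition enc_input (n : nat) (f : dnf n) (p c : 'I_n -> rat)
    (h : seq ('I_n * bool)) : tree :=
  Node (enc_instance f p c) (enc_history h).

Section ProgramValues.

Variables (n : nat) (f : dnf n) (p c : 'I_n -> rat) (h : seq ('I_n * bool)).

Local Notation inp := (enc_input f p c h).
Local Notation enc_term := (enc_seq (@enc_var n)).

Lemma den_pcost env k e (v : 'I_n) :
  nth Leaf env k = inp -> den env e = enc_var v ->
  den env (pcost k e) = enc_rat (c v).
Proof.
rewrite enc_varE => hk he.
have hc : den env (pcosts k) = enc_seq enc_rat [seq c i | i <- enum 'I_n].
  by rewrite /= hk.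
rewrite -[LHS]/(hd (den env (pdrop e (pcosts k)))) (den_pdrop he hc).
have vn : v < size [seq c i | i <- enum 'I_n] by rewrite size_map size_enum_ord.
rewrite size_nseq (drop_nth 0%R vn) /=.
by rewrite (nth_map v) ?size_enum_ord // nth_ord_enum.
Qed.

Definition enc_entry (o : option ('I_n * bool)) : tree :=
  if o is Some iv then Node (enc_var iv.1) (enc_bool iv.2) else Leaf.

Lemma den_plookup env k i (v : 'I_n) :
  nth Leaf env k = inp -> nth Leaf env i = enc_var v ->
  exists2 o, den env (plookup k i) = enc_entry o & omap snd o = known h v.
Proof.
move=> hk hi; pose step (u : seq ('I_n * bool)) a :=
  if u is iv :: _ then if iv.1 == v then Some iv else a else a.
exists (sfold step h None).
  apply: (den_fold (E := enc_entry)); first by rewrite /= hk.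
  - by [].
  - move=> iv s a; rewrite den_PIf.
    rewrite (den_pvar_eq (i := iv.1) (j := v)) // truthy_enc_bool /=.
    by case: (iv.1 == v).
(* Both folds traverse [h] in the same order, a later entry for v overriding an earlier one. *)
have: omap snd (None : option ('I_n * bool)) = unknown n v by rewrite ffunE.
rewrite /known; elim: h None (unknown n) => //= iv s IH a b ab; apply: IH.
by rewrite learnE [v == _]eq_sym; case: eqP.
Qed.

Lemma den_pdead env k i t :
  nth Leaf env k = inp -> nth Leaf env i = enc_term t ->
  den env (pdead k i) = enc_bool (dead (known h) t).
Proof.
move=> hk hi; apply: (den_fold_has (enc := @enc_var n)) => // v s a.
rewrite den_PLet den_PLet; set env1 := [:: _, _, _ & env].
have [//|//|o -> <-] := @den_plookup env1 k.+3 0 v.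
by rewrite {}/env1; case: o => [[i' []]|]; case: a.
Qed.

Lemma den_pfind env k i t :
  nth Leaf env k = inp -> nth Leaf env i = enc_term t ->
  den env (pfind_undecided k i)
    = enc_term (suffix_find (undecided (known h)) t).
Proof.
move=> hk hi; pose step (u a : seq 'I_n) := if nilp a then
  if u is v :: _ then if undecided (known h) v then u else a else a else a.
have -> : suffix_find (undecided (known h)) t = sfold step t [::].
  have keep s u a : sfold step s (u :: a) = u :: a.
    by elim: s => // x s IH; exact: IH.
  have step0 v s : step (v :: s) [::] =
      if undecided (known h) v then v :: s else [::] by [].
  by elim: (t) => //= v s ->; rewrite step0; case: ifP; rewrite ?keep.
apply: (den_fold (enc := @enc_var n) (E := enc_term)) => // v s a.
rewrite den_PIf.
rewrite [den _ (PVar 1)]/= truthy_enc_seq /step; case: (nilp a) => //.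
rewrite den_PLet den_PIf; set env1 := [:: _, _, _ & env].
have [//|//|o -> eo] := @den_plookup env1 k.+3 0 v.
by rewrite /undecided -eo; case: o {eo}.
Qed.

Lemma den_pterm_lt env k t t' :
  nth Leaf env k = inp ->
  den [:: enc_term t, enc_term t' & env] (pterm_lt k.+2)
    = enc_bool (term_lt rat_lt c t t').
Proof.
move=> hk; apply: (den_fold_has (enc := @enc_var n)) => // v' s' a'.
apply: den_por => //; apply: (den_fold_all (enc := @enc_var n)) => // v s a.
apply: den_pand => //.
rewrite 2!den_PLet; set env1 := (X in den X (pcost k.+2.+4 _)).
rewrite (@den_pcost env1 _ _ v') // (@den_pcost (_ :: env1) _ _ v) //.
exact: den_prat_lt.
Qed.

Lemma den_psatisfied :
  den [:: inp] psatisfied = enc_bool (satisfied (known h) f).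
Proof.
apply: (den_fold_has (enc := enc_term)) => // t s a.
rewrite den_PLet; set env1 := (X in den X _).
apply: den_por => //; apply: den_pand.
  by apply: den_pnot; exact: den_pdead.
rewrite den_PIf (@den_pfind env1 3 0 t) // truthy_enc_seq.
rewrite nilp_suffix_find.
by case: (has _ t).
Qed.

Lemma den_psel :
  den [:: inp] psel
    = enc_seq enc_term (sel (term_lt rat_lt c) (dead (known h)) f).
Proof.
apply: (den_fold (enc := enc_term) (E := enc_seq enc_term)) => // t s a.
rewrite den_PLet den_PIf (@den_pdead _ 3 0 t) // truthy_enc_bool /sel_step.
case: ifP => // _; rewrite den_PIf; case: a => [|t' a] //.
rewrite [truthy _]/= 2!den_PLet den_PIf (@den_pterm_lt _ 3 t t') //.
by rewrite truthy_enc_bool; case: ifP.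
Qed.

End ProgramValues.

(** The program has neither fuel nor a fallback for a selected term without open variables. Neither
    matters: the fuel suffices, and a live term has an open variable as long as b does not satisfy
    f. *)
Lemma den_pmain n (f : dnf n) (p c : 'I_n -> rat) h fuel :
  (forall i, (0 <= c i)%R) -> open_count (known h) <= fuel ->
  den [:: enc_input f p c h] pmain
    = enc_next (dnf_strategy rat_lt c f fuel (known h)).
Proof.
move=> c0; rewrite /pmain den_PIf den_psatisfied truthy_enc_bool.
case: (boolP (satisfied _ f)) => [sat|ns] hfuel.
  by case: fuel {hfuel} => [|fuel]; rewrite /= sat.
rewrite den_PLet den_psel den_PIf [den _ (PVar 0)]/= truthy_enc_seq.
have := sel_spec (dead (known h)) f (fun t t' => term_lt_max c0 rat_lt_le)
  (fun t t' => max_term_lt c0 rat_double_lt) (fun t => term_max_ge0 t c0).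
case Es: (sel _ _ _) => [|t u].
  by case: fuel {hfuel} => [|fuel] _; rewrite /= (negbTE ns) Es.
rewrite (_ : nilp _ = false) // => -[tf al _].
have un : has (undecided (known h)) t.
  by apply: contraNT ns => un; apply/hasP; exists t => //; rewrite al.
have [i [s [Ei /eqP bi _]]] := suffix_findP un.
case: fuel hfuel => [|fuel] hfuel.
  by rewrite (open_count_learn true bi) in hfuel.
rewrite /dnf_strategy -/dnf_strategy (negbTE ns) Es Ei den_PLet.
set env1 := [:: den _ _, _ & _].
rewrite -[LHS]/(Node (enc_bool true) (hd (den env1 (pfind_undecided 2 0)))).
by rewrite (@den_pfind n f p c h _ 2 0 t) // Ei.
Qed.

Lemma known_rcons n (h : seq ('I_n * bool)) i v :
  known (rcons h (i, v)) = learn (known h) i v.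
Proof. by rewrite /known foldl_rcons. Qed.

(** The equation on [size h] is an invariant because only open variables are tested; it keeps
    histories within the length n for which the running time is bounded. *)
Lemma dnf_strategy_computes n A (f : dnf n) (p c : 'I_n -> rat) T fuel h :
  (forall i, (0 <= c i)%R) ->
  (forall h, size h <= n -> runs_within A (enc_input f p c h)
     (den [:: enc_input f p c h] pmain) T) ->
  size h + open_count (known h) = n -> open_count (known h) <= fuel ->
  computes A f p c T h (dnf_strategy rat_lt c f fuel (known h)).
Proof.
move=> c0 hA; elim: fuel h => [|fuel IH] h hn hfuel;
  have := hA h (leq_trans (leq_addr _ _) (eq_leq hn));
  rewrite (den_pmain f p c0 hfuel);
  have := dnf_strategy_evaluates f c0 rat_lt_le rat_double_lt hfuel;
  rewrite /=; case: (satisfied _ f) => //;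
  case: (sel _ _ _) => // t _; case: (suffix_find _ t) => // i _ [bi _ _ _] run.
have next v : computes A f p c T (rcons h (i, v))
    (dnf_strategy rat_lt c f fuel (learn (known h) i v)).
  have oc := open_count_learn v bi.
  by rewrite -known_rcons; apply: IH; rewrite ?size_rcons known_rcons; lia.
by split; last split.
Qed.

(** * Input size and conclusion *)

Lemma tree_size_enc_seq_le (T : Type) (enc : T -> tree) s B :
  (forall x, tree_size (enc x) <= B) ->
  tree_size (enc_seq enc s) <= size s * B.+1 + 1.
Proof. by move=> hB; elim: s => //= x s IH; have := hB x; nia. Qed.

Lemma size_lt_enc_seq (T : Type) (enc : T -> tree) s :
  size s < tree_size (enc_seq enc s).
Proof. by elim: s => //= x s IH; lia. Qed.

(** The history has at most n entries of size linear in n, and n is below the size of the instance,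
    which lists n costs. *)
Lemma tree_size_enc_input n (f : dnf n) (p c : 'I_n -> rat) h :
  size h <= n ->
  tree_size (enc_input f p c h) <= 9 * tree_size (enc_instance f p c) ^ 2.
Proof.
move=> hn; set N := tree_size (enc_instance f p c).
have nN : n < N.
  have := size_lt_enc_seq enc_rat [seq c i | i <- enum 'I_n].
  by rewrite /N size_map size_enum_ord /=; lia.
have hB (iv : 'I_n * bool) :
    tree_size (Node (enc_var iv.1) (enc_bool iv.2)) <= 2 * n + 3.
  have -> : tree_size (Node (enc_var iv.1) (enc_bool iv.2)) =
      2 * iv.1 + 2 + tree_size (enc_bool iv.2).
    rewrite /= /enc_var; elim: (iv.1 : nat) => //= m; lia.
  by have := ltn_ord iv.1; case: (iv.2) => /=; lia.
have := tree_size_enc_seq_le h hB; rewrite -/(enc_history h) => hh.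
have -> : tree_size (enc_input f p c h) = (N + tree_size (enc_history h)).+1.
  by [].
have : size h * (2 * n + 3).+1 <= n * (2 * n + 3).+1.
  by rewrite leq_mul2r hn orbT.
rewrite expnS expn1; nia.
Qed.

Local Open Scope ring_scope.

Theorem theorem2 :
  exists (A : cmd) (a d : nat),
    forall (n k : nat) (f : dnf n) (p c : 'I_n -> rat),
      is_kdnf k f ->
      (forall i, 0 < p i < 1) ->
      (forall i, 0 <= c i) ->
      exists S : strategy n,
        [/\ computes A f p c (a * tree_size (enc_instance f p c) ^ d)%N [::] S,
            evaluates f (unknown n) S
          & expectation p (strategy_cost c S)
              <= 4 / rho p ^+ k * expectation p (CERT f c)].
Proof.
have [a [d run]] := main_cmd_runs pmain_folds_small.
(* These constants come from expanding a * (9 * N ^ 2) ^ d, for N the size of the instance. *)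
exists (main_cmd pmain), (a * 9 ^ d)%N, (2 * d)%N => n k f p c fk hp c0.
have on : open_count (unknown n) = n.
  rewrite /open_count -[RHS]card_ord; apply: eq_card => i.
  by rewrite !inE /undecided ffunE.
exists (dnf_strategy rat_lt c f n (unknown n)); split.
- apply: (dnf_strategy_computes (h := [::])) => //; last by rewrite on.
  move=> h /(tree_size_enc_input f p c) hh.
  have [t [s [ex out tle]]] := run (enc_input f p c h).
  exists t, s; split=> //; apply: leq_trans tle _.
  rewrite -mulnA expnM -expnMn leq_mul2l; apply/orP; right.
  by case: (d) => // d'; rewrite leq_exp2r.
- apply: dnf_strategy_evaluates; rewrite ?on //; first exact: rat_lt_le.
  exact: rat_double_lt.
- rewrite -!cexp_unknown; apply: dnf_strategy_cost => //; rewrite ?on //.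
    exact: rat_lt_le.
  exact: rat_double_lt.
Qed.
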